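(* Let $$G=\langle a,b,c \mid a^2=1,\ b^2=1,\ c^2=1,\ (ab)^2=1,\ (ac)^3=1 \rangle$$ (a group isomorphic to $\mathrm{PGL}(2,\mathbb{Z})$) and let $S=\{a,b,c\}$. Then $\omega(G,S)=\alpha$, where $\alpha$ is the unique positive root of the polynomial $z^3-z-1$.
   Context: For a group $G$ generated by a finite set $S$, the length $\ell_{G,S}(g)$ of $g\in G$ is the minimal integer $n\ge 0$ such that $g=x_1x_2\cdots x_n$ with all $x_i\in S\cup S^{-1}$. Let $F_{G,S}(n)$ be the number of $g\in G$ with $\ell_{G,S}(g)\le n$. The exponential growth rate of $G$ with respect to $S$ is $\omega(G,S)=\lim_{n\to\infty}(F_{G,S}(n))^{1/n}$ (the limit always exists). *)

(* Defs.v *)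
From HB Require Import structures.
From mathcomp Require Import all_boot all_order all_algebra generic_quotient finmap.
From mathcomp Require Import all_classical all_reals all_analysis.

Set Implicit Arguments.
Unset Strict Implicit.
Unset Printing Implicit Defensive.

Import Order.TTheory GRing.Theory Num.Theory.
Import numFieldNormedType.Exports.

Local Open Scope fset_scope.
Local Open Scope group_scope.
Local Open Scope quotient_scope.

Section Growth.
Variable G : groupType.
Implicit Types (S : {fset G}) (g : G).

Definition is_product S (n : nat) g : Prop :=
  exists xs : seq G,
    [/\ size xs = n,
        {subset xs <= S `|` [fset x^-1 | x in S]} &
        g = \big[*%g/1]_(x <- xs) x].

Definition generates S : Prop := forall g, exists n, is_product S n g.

Lemma generates_asbool S :
  generates S -> forall g, exists n, `[< is_product S n g >].
Proof. by move=> genS g; have [n gn] := genS g; exists n; apply/asboolP. Qed.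

Definition word_length S (genS : generates S) g : nat :=
  ex_minn (generates_asbool genS g).

(* [fset_set] is the empty set on infinite sets; balls are finite because
   [S] is, so the cardinal below is the genuine one. *)
Definition growth_function S (genS : generates S) (n : nat) : nat :=
  #|` fset_set [set g | (word_length genS g <= n)%N]%classic|.

Definition growth_root (R : realType) S (genS : generates S) (n : nat) : R :=
  ((growth_function genS n)%:R `^ n%:R^-1)%R.

Definition growth_rate (R : realType) S (genS : generates S) : R :=
  limn (growth_root R genS).

End Growth.

(* The letter [(x, false)] stands for the generator x, and [(x, true)] for
   its inverse. *)
Definition word (X : choiceType) : choiceType := seq (X * bool).

Definition inv_letter (X : choiceType) (l : X * bool) : X * bool :=
  (l.1, ~~ l.2).

Definition inv_word (X : choiceType) (w : word X) : word X :=
  rev (map (@inv_letter X) w).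

(* The congruence on words generated by free cancellation and by r = 1 for
   every relator r in [rels]: its quotient is the free group on X modulo the
   normal closure of [rels]. *)
Inductive word_eq (X : choiceType) (rels : seq (word X)) :
    word X -> word X -> Prop :=
| word_eq_refl w : word_eq rels w w
| word_eq_sym v w : word_eq rels v w -> word_eq rels w v
| word_eq_trans u v w :
    word_eq rels u v -> word_eq rels v w -> word_eq rels u w
| word_eq_cat v v' w w' :
    word_eq rels v v' -> word_eq rels w w' -> word_eq rels (v ++ w) (v' ++ w')
| word_eq_cancel l : word_eq rels [:: l; inv_letter l] [::]
| word_eq_relator r : r \in rels -> word_eq rels r [::].

Section Presented.
Variables (X : choiceType) (rels : seq (word X)).

Definition word_eqb : rel (word X) := fun v w => `[< word_eq rels v w >].

Lemma word_eqb_refl : reflexive word_eqb.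
Proof. by move=> w; apply/asboolP; apply: word_eq_refl. Qed.

Lemma word_eqb_sym : symmetric word_eqb.
Proof.
by move=> v w; apply/asboolP/asboolP => /word_eq_sym.
Qed.

Lemma word_eqb_trans : transitive word_eqb.
Proof.
by move=> v u w /asboolP uv /asboolP vw; apply/asboolP; apply: word_eq_trans vw.
Qed.

Canonical word_eqb_equiv :=
  EquivRel word_eqb word_eqb_refl word_eqb_sym word_eqb_trans.

Definition presented : Type := {eq_quot word_eqb}.
HB.instance Definition _ := Choice.on presented.

Definition pres_class (w : word X) : presented := \pi_({eq_quot word_eqb}) w.
Definition pres_word (g : presented) : word X := repr (g : {eq_quot word_eqb}).

Definition pres_one : presented := pres_class [::].
Definition pres_mul (g h : presented) : presented :=
  pres_class (pres_word g ++ pres_word h).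
Definition pres_inv (g : presented) : presented :=
  pres_class (inv_word (pres_word g)).

Lemma pres_wordK (g : presented) : pres_class (pres_word g) = g.
Proof. exact: reprK. Qed.

Lemma pres_classP (v w : word X) :
  pres_class v = pres_class w <-> word_eq rels v w.
Proof.
split=> [/eqmodP/asboolP //|vw].
by apply/eqmodP; apply/asboolP.
Qed.

Lemma pres_classK (w : word X) : word_eq rels (pres_word (pres_class w)) w.
Proof. by apply/pres_classP; rewrite pres_wordK. Qed.

Lemma pres_mulE (v w : word X) :
  pres_mul (pres_class v) (pres_class w) = pres_class (v ++ w).
Proof. by apply/pres_classP; apply: word_eq_cat; apply: pres_classK. Qed.

Lemma pres_mulA : associative pres_mul.
Proof.
move=> f g h; rewrite -(pres_wordK f) -(pres_wordK g) -(pres_wordK h).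
by rewrite !pres_mulE catA.
Qed.

Lemma pres_mul1 : left_id pres_one pres_mul.
Proof. by move=> g; rewrite -(pres_wordK g) pres_mulE. Qed.

Lemma pres_mulr1 : right_id pres_one pres_mul.
Proof. by move=> g; rewrite -(pres_wordK g) pres_mulE cats0. Qed.

Lemma inv_letterK : involutive (@inv_letter X).
Proof. by case=> x e; rewrite /inv_letter negbK. Qed.

Lemma inv_wordK : involutive (@inv_word X).
Proof.
by move=> w; rewrite /inv_word map_rev revK -map_comp map_id_in// => l _ /=;
   rewrite inv_letterK.
Qed.

Lemma word_eq_inv_word (w : word X) : word_eq rels (w ++ inv_word w) [::].
Proof.
elim: w => [|l w IHw]; first exact: word_eq_refl.
have ->: inv_word (l :: w) = inv_word w ++ [:: inv_letter l].
  by rewrite /inv_word /= rev_cons cats1.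
apply: (word_eq_trans _ (word_eq_cancel rels l)).
rewrite -cat1s -[[:: l; _]]/([:: l] ++ [::] ++ [:: inv_letter l]) catA -catA.
rewrite -(catA [:: l]) (catA w); apply: word_eq_cat; first exact: word_eq_refl.
by apply: word_eq_cat => //; exact: word_eq_refl.
Qed.

Lemma pres_mulgV : right_inverse pres_one pres_inv pres_mul.
Proof.
move=> g; rewrite -{1}(pres_wordK g) pres_mulE.
by apply/pres_classP; apply: word_eq_inv_word.
Qed.

Lemma pres_mulVg : left_inverse pres_one pres_inv pres_mul.
Proof.
move=> g; rewrite -{2}(pres_wordK g) pres_mulE; apply/pres_classP.
by rewrite -{2}[pres_word g]inv_wordK; apply: word_eq_inv_word.
Qed.

HB.instance Definition _ := isGroup.Build presented
  pres_mulA pres_mul1 pres_mulr1 pres_mulVg pres_mulgV.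

Definition pres_gen (x : X) : presented := pres_class [:: (x, false)].

Lemma pres_genV (x : X) : (pres_gen x)^-1 = pres_class [:: (x, true)].
Proof.
apply/(mulgI (pres_gen x)); rewrite mulgV /pres_gen.
rewrite [RHS]pres_mulE; apply/esym/pres_classP.
exact: (word_eq_cancel rels (x, false)).
Qed.

Lemma presented_generates (S : {fset presented}) :
  (forall x, pres_gen x \in S) -> generates S.
Proof.
move=> genS g; rewrite -(pres_wordK g); elim: (pres_word g) => [|[x e] w IHw].
  by exists 0%N, [::]; rewrite big_nil.
have [n [xs [xsn xsS wE]]] := IHw.
exists n.+1, (pres_class [:: (x, e)] :: xs); split; first by rewrite /= xsn.
  move=> y; rewrite inE => /predU1P[->|/xsS//].
  rewrite inE; apply/orP; case: e.
    by right; rewrite -pres_genV; apply/imfsetP; exists (pres_gen x) => //=.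
  by left; apply: genS.
by rewrite big_cons -wE; apply/esym; apply: pres_mulE.
Qed.

End Presented.

Definition letter_a : 'I_3 * bool := (inord 0, false).
Definition letter_b : 'I_3 * bool := (inord 1, false).
Definition letter_c : 'I_3 * bool := (inord 2, false).

Definition Gabc_relators : seq (word 'I_3) :=
  [:: [:: letter_a; letter_a];
      [:: letter_b; letter_b];
      [:: letter_c; letter_c];
      [:: letter_a; letter_b; letter_a; letter_b];
      [:: letter_a; letter_c; letter_a; letter_c; letter_a; letter_c]].

Definition Gabc : groupType := presented Gabc_relators.

Definition gen_a : Gabc := pres_class Gabc_relators [:: letter_a].
Definition gen_b : Gabc := pres_class Gabc_relators [:: letter_b].
Definition gen_c : Gabc := pres_class Gabc_relators [:: letter_c].

Definition Gabc_gens : {fset Gabc} := [fset gen_a; gen_b; gen_c].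

Lemma Gabc_gens_generate : generates Gabc_gens.
Proof.
apply: presented_generates => x; rewrite !inE /pres_gen.
have : x \in [:: inord 0; inord 1; inord 2 : 'I_3].
  by rewrite !inE -!val_eqE /= !inordK //; case: x => -[|[|[|]]].
by rewrite !inE => /or3P[] /eqP ->; rewrite eqxx ?orbT.
Qed.

(* Main.v *)
Require Import Defs.
From mathcomp Require Import all_boot all_order all_algebra finmap.
From mathcomp Require Import all_classical all_reals all_analysis.
From mathcomp Require Import ring lra zify.
Import Order.TTheory GRing.Theory Num.Theory.
Import numFieldNormedType.Exports.
Local Open Scope classical_set_scope.
Local Open Scope ring_scope.

(** The group G is the amalgam of <a, b>, of order 4, and <a, c>, of order 6,
    over their common subgroup <a>.  Taking {1, b} and {1, c, ac} as coset
    representatives of <a> in the two factors, every element is uniquely an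
    alternating product of factors b and factors from {c, ac}, followed by a
    power of a.  Grouping each of c and ac with the b after it, the normal
    form reads
      b^d . (a^e1 c b) ... (a^ek c b) . (a^e or a^e c a^e'),
    with all exponents in {0, 1}.

    Existence and uniqueness of this form come from one action: the rules for
    left multiplication by a, b and c define three maps on formal normal forms
    ([act_a], [act_b], [act_c]) that satisfy the relations of G, so G acts on
    normal forms.  Evaluating a normal form in G is equivariant ([value_act]),
    and a normal form is recovered by letting its value act on the empty one
    ([act_value]); hence the two are in bijection ([formK], [valueK]).
    Multiplying by a generator lengthens the normal form by at most one letter
    ([form_length_act]), so normal forms are geodesic ([word_lengthE]).

    Growth is now a count of sequences of blocks cb (length 2) and acb
    (length 3): a normal form has, besides its blocks, only 2 * 6 possible ends,
    whence P(n) <= F(n) <= 12 P(n) for P(n) the number of block sequences of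
    total length at most n ([growth_function_bounds]).  Removing the first block
    gives P(n+3) = P(n+1) + P(n) + 1, whose characteristic equation is
    z^3 = z + 1, so P(n) is squeezed between two constant multiples of alpha^n
    ([blocks_bounds]), and n-th roots converge to alpha
    ([exponential_growth_rate]). *)

(** * Relations between the generators *)

Section Group.
Local Open Scope group_scope.

Lemma class_cat v w : pres_class Gabc_relators v * pres_class Gabc_relators w
  = pres_class Gabc_relators (v ++ w) :> Gabc.
Proof. exact: pres_mulE. Qed.

Lemma class_prod w : pres_class Gabc_relators w
  = \prod_(l <- w) pres_class Gabc_relators [:: l] :> Gabc.
Proof.
elim: w => [|l w IHw]; first by rewrite big_nil.
by rewrite big_cons -IHw class_cat.
Qed.

Lemma relator_trivial i : (i < 5)%N ->
  pres_class Gabc_relators (nth [::] Gabc_relators i) = 1 :> Gabc.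
Proof. by move=> i5; apply/pres_classP/word_eq_relator/mem_nth. Qed.

Lemma gen_aa : gen_a * gen_a = 1.
Proof.
by have := @relator_trivial 0 isT; rewrite class_prod !big_cons big_nil mulg1.
Qed.

Lemma gen_bb : gen_b * gen_b = 1.
Proof.
by have := @relator_trivial 1 isT; rewrite class_prod !big_cons big_nil mulg1.
Qed.

Lemma gen_cc : gen_c * gen_c = 1.
Proof.
by have := @relator_trivial 2 isT; rewrite class_prod !big_cons big_nil mulg1.
Qed.

Lemma gen_aK g : gen_a * (gen_a * g) = g.
Proof. by rewrite mulgA gen_aa mul1g. Qed.

Lemma gen_bK g : gen_b * (gen_b * g) = g.
Proof. by rewrite mulgA gen_bb mul1g. Qed.

Lemma gen_cK g : gen_c * (gen_c * g) = g.
Proof. by rewrite mulgA gen_cc mul1g. Qed.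

Lemma gen_abC g : gen_a * (gen_b * g) = gen_b * (gen_a * g).
Proof.
suff h : gen_a * (gen_b * (gen_a * gen_b)) = 1.
  rewrite -[in LHS](gen_aK g) -{1}(gen_bK (gen_a * g)) 3!mulgA.
  by rewrite -[X in X * (gen_b * _)]mulgA -mulgA h mul1g.
by have := @relator_trivial 3 isT; rewrite class_prod !big_cons big_nil mulg1.
Qed.

(** The braid form of (ac)^3 = 1: a c in front of ac disappears and an a comes
    out on the right, so that {1, c, ac} represents all cosets of <a>. *)
Lemma gen_cac g :
  gen_c * (gen_a * (gen_c * g)) = gen_a * (gen_c * (gen_a * g)).
Proof.
have h : gen_a * (gen_c * (gen_a * (gen_c * (gen_a * gen_c)))) = 1.
  by have := @relator_trivial 4 isT; rewrite class_prod !big_cons big_nil mulg1.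
have {}h x : gen_a * (gen_c * (gen_a * (gen_c * (gen_a * (gen_c * x))))) = x.
  by rewrite -[RHS]mul1g -h !mulgA.
by apply: esym; rewrite -[in LHS](h g) gen_aK gen_cK gen_aK.
Qed.

Lemma gen_inv x : x \in Gabc_gens -> x^-1 = x.
Proof.
have sq (g : Gabc) : g * g = 1 -> g^-1 = g.
  by move=> gg; apply/(mulgI g); rewrite mulgV.
by rewrite !inE => /orP[/orP[]|] /eqP->; apply: sq;
  rewrite (gen_aa, gen_bb, gen_cc).
Qed.

Lemma gens_symmetric :
  (Gabc_gens `|` [fset x^-1 | x in Gabc_gens])%fset = Gabc_gens.
Proof.
apply/fsetP => x; rewrite in_fsetU; apply/orP/idP => [[//|]|]; last by left.
by case/imfsetP => y /= yS ->; rewrite gen_inv.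
Qed.

(** * Normal forms and the action of the group on them *)

(** A normal form without its initial b.  The sequence lists the exponents of a
    in the blocks a^e c b; the pair (e, None) stands for a final a^e, and
    (e, Some e') for a final a^e c a^e'. *)
Definition tail : Type := seq bool * (bool * option bool).
Definition normal_form : Type := bool * tail.

Definition end_word (f : bool * option bool) : seq Gabc :=
  nseq f.1 gen_a ++ (if f.2 is Some e then gen_c :: nseq e gen_a else [::]).

Fixpoint tail_word (s : seq bool) (f : bool * option bool) : seq Gabc :=
  if s is e :: s' then nseq e gen_a ++ [:: gen_c, gen_b & tail_word s' f]
  else end_word f.

Definition normal_word (x : normal_form) : seq Gabc :=
  nseq x.1 gen_b ++ tail_word x.2.1 x.2.2.

Definition normal_one : normal_form := (false, ([::], (false, None))).

(** Left multiplication by a: it changes the first exponent of a, which sits in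
    the first block, or in the end when there are no blocks. *)
Definition toggle (t : tail) : tail :=
  match t with
  | ([::], (e, o)) => ([::], (~~ e, o))
  | (e :: s, f) => (~~ e :: s, f)
  end.

(** An initial b commutes with a, so that a acts on the tail behind it. *)
Definition act_a (x : normal_form) : normal_form := (x.1, toggle x.2).
Definition act_b (x : normal_form) : normal_form := (~~ x.1, x.2).

(** The case c . a c w is rewritten as a c . a w; here a w is again a tail
    because the b that may follow c commutes with a. *)
Definition act_c (x : normal_form) : normal_form :=
  match x with
  | (true, (s, f)) => (false, (false :: s, f))
  | (false, (false :: s, f)) => (true, (s, f))
  | (false, (true :: s, f)) =>
      let t := toggle (s, f) in (false, (true :: t.1, t.2))
  | (false, ([::], (e, None))) => (false, ([::], (false, Some e)))
  | (false, ([::], (false, Some e))) => (false, ([::], (e, None)))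
  | (false, ([::], (true, Some e))) => (false, ([::], (true, Some (~~ e))))
  end.

Definition act_letter (l : 'I_3 * bool) : normal_form -> normal_form :=
  match val l.1 with 0%N => act_a | 1%N => act_b | _ => act_c end.

Definition act_word (w : word 'I_3) (x : normal_form) : normal_form :=
  foldr act_letter x w.

Lemma toggleK : involutive toggle.
Proof. by case=> [[|e s] [f o]] /=; rewrite negbK. Qed.

Lemma act_aK : involutive act_a.
Proof. by case=> d t; rewrite /act_a /= toggleK. Qed.

Lemma act_bK : involutive act_b.
Proof. by case=> d t; rewrite /act_b /= negbK. Qed.

Lemma act_cK : involutive act_c.
Proof. by case=> [[] [[|[] [|[] s]] [[] [[]|]]]]. Qed.

Lemma act_letterK l : involutive (act_letter l).
Proof.
rewrite /act_letter; case: (val _) => [|[|n]];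
  [exact: act_aK | exact: act_bK | exact: act_cK].
Qed.

(** A relator reads no more of a form than the initial b, two blocks and the
    end, so that computation on finitely many shapes decides each case. *)
Lemma act_relator r : r \in Gabc_relators -> act_word r =1 id.
Proof.
have aE : act_letter letter_a = act_a by rewrite /act_letter /= inordK.
have bE : act_letter letter_b = act_b by rewrite /act_letter /= inordK.
have cE : act_letter letter_c = act_c by rewrite /act_letter /= inordK.
by rewrite !inE => /or4P[|||/orP[]] /eqP-> [[] [[|[] [|[] s]] [[] [[]|]]]];
  rewrite /act_word /= !(aE, bE, cE).
Qed.

Lemma act_word_eq v w : word_eq Gabc_relators v w -> act_word v =1 act_word w.
Proof.
elim=> {v w} [//|v w _ IH x|u v w _ IH1 _ IH2 x|v v' w w' _ IH1 _ IH2 x|l x|].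
- by rewrite IH.
- by rewrite IH1.
- by rewrite /act_word !foldr_cat -!/(act_word _ _) IH2 IH1.
- by rewrite /act_word /=; exact: act_letterK.
- by move=> r; exact: act_relator.
Qed.

Definition act (g : Gabc) : normal_form -> normal_form :=
  act_word (pres_word g).

Lemma act_class w : act (pres_class Gabc_relators w) =1 act_word w.
Proof. by apply: act_word_eq; apply: pres_classK. Qed.

Lemma actM g h x : act (g * h) x = act g (act h x).
Proof.
by rewrite [act (g * h) x]act_class /act_word foldr_cat.
Qed.

Lemma act1 x : act 1 x = x.
Proof. by rewrite [act 1 x]act_class. Qed.

Lemma act_gen_a : act gen_a =1 act_a.
Proof. by move=> x; rewrite act_class /= /act_letter /= inordK. Qed.

Lemma act_gen_b : act gen_b =1 act_b.
Proof. by move=> x; rewrite act_class /= /act_letter /= inordK. Qed.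

Lemma act_gen_c : act gen_c =1 act_c.
Proof. by move=> x; rewrite act_class /= /act_letter /= inordK. Qed.

Definition act_gens := (act_gen_a, act_gen_b, act_gen_c).

Definition value (x : normal_form) : Gabc := \prod_(g <- normal_word x) g.

(** Each letter of a normal word, read from the right, acts by being prepended:
    no rewriting occurs.  This gives the uniqueness of normal forms. *)
Lemma act_value x : act (value x) normal_one = x.
Proof.
have aval t : act (value (false, t)) normal_one = (false, t).
  case: t => s f; rewrite /value /normal_word /=; elim: s => [|e s IHs].
    by case: f => [[] [[]|]];
      rewrite /= ?(big_cons, big_nil) ?(actM, act1) ?act_gens.
  by case: e; rewrite /= !big_cons !actM IHs !act_gens.
case: x => [[] t]; last exact: aval.
by rewrite /value /normal_word /= big_cons actM aval act_gens.
Qed.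

Lemma value_toggle t : value (false, toggle t) = gen_a * value (false, t).
Proof.
by case: t => [[|[] s] [[] [[]|]]];
  rewrite /value /normal_word /= ?(big_cons, big_nil, gen_aK).
Qed.

Lemma value_b t : value (true, t) = gen_b * value (false, t).
Proof. by rewrite /value /normal_word /= big_cons. Qed.

Lemma value_act_a x : value (act_a x) = gen_a * value x.
Proof.
by case: x => [[] t]; rewrite /act_a /= ?value_b value_toggle // gen_abC.
Qed.

Lemma value_act_b x : value (act_b x) = gen_b * value x.
Proof. by case: x => [[] t]; rewrite /act_b /= value_b ?gen_bK. Qed.

Lemma value_cb e s f :
  value (false, (e :: s, f)) =
    gen_a ^+ e * (gen_c * (gen_b * value (false, (s, f)))).
Proof.
by case: e; rewrite /value /normal_word /= ?(expg1, expg0, mul1g) !big_cons.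
Qed.

Lemma value_act_c x : value (act_c x) = gen_c * value x.
Proof.
case: x => [[] [s f]] /=.
  by rewrite value_cb value_b mul1g.
case: s => [|[] s].
- case: f => [[] [[]|]]; rewrite /value /normal_word /= ?(big_cons, big_nil) //;
    by rewrite ?gen_cK // gen_cac ?gen_aa ?gen_aK ?mulg1.
- rewrite !value_cb expg1 -(surjective_pairing (toggle (s, f))) value_toggle.
  by rewrite gen_cac gen_abC.
- by rewrite value_cb mul1g gen_cK value_b.
Qed.

Lemma class_letter (l : 'I_3 * bool) : pres_class Gabc_relators [:: l] =
  match val l.1 with 0%N => gen_a | 1%N => gen_b | _ => gen_c end.
Proof.
have genE (i : 'I_3) : pres_gen Gabc_relators i =
    match val i with 0%N => gen_a | 1%N => gen_b | _ => gen_c end.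
  case: i => -[|[|[|//]]] i3; congr (pres_class _ [:: (_, _)]);
    by apply: val_inj; rewrite /= inordK.
case: l => i [] /=; last exact: genE.
rewrite -pres_genV genE gen_inv //.
by case: (val i) => [|[|n]]; rewrite !inE eqxx ?orbT.
Qed.

(** Applied to the empty normal form, this yields the existence of normal forms:
    g is the value of the normal form that g produces from it. *)
Lemma value_act g x : value (act g x) = g * value x.
Proof.
rewrite -[in RHS](pres_wordK g) /act; elim: (pres_word g) => [|l w IHw] /=.
  by rewrite [X in X * _](_ : _ = 1) ?mul1g.
rewrite -cat1s -class_cat -mulgA -IHw class_letter.
by rewrite /act_letter; case: (val _) => [|[|n]];
  rewrite (value_act_a, value_act_b, value_act_c).
Qed.

Definition form (g : Gabc) : normal_form := act g normal_one.

Lemma formK : cancel form value.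
Proof.
by move=> g; rewrite /form value_act /value /normal_word /= big_nil mulg1.
Qed.

Lemma valueK : cancel value form.
Proof. exact: act_value. Qed.

(** * Word length *)

Definition form_length (x : normal_form) : nat := size (normal_word x).

Lemma form_length_cons e s f :
  form_length (false, (e :: s, f)) = (e.+2 + form_length (false, (s, f)))%N.
Proof.
by rewrite /form_length /normal_word /= size_cat size_nseq /= !addnS addSn.
Qed.

Lemma form_length_b t :
  form_length (true, t) = (form_length (false, t)).+1.
Proof. by []. Qed.

Lemma form_length_toggle t :
  (form_length (false, toggle t) <= (form_length (false, t)).+1)%N.
Proof.
case: t => [[|e s] [f o]]; last by rewrite !form_length_cons; case: e; lia.
by case: f; case: o => [[]|].
Qed.

(** In the only rule that recurses, c . a c w = a c . a w, the added length is
    that of w changing into a w. *)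
Lemma form_length_act g x : g \in Gabc_gens ->
  (form_length (act g x) <= (form_length x).+1)%N.
Proof.
rewrite !inE => /orP[/orP[]|] /eqP->; rewrite act_gens.
- by case: x => -[] t;
    rewrite /act_a /= ?form_length_b ?ltnS form_length_toggle.
- by case: x => -[] t; rewrite /act_b /= ?form_length_b // ltnW.
case: x => -[] [s f] /=; first by rewrite form_length_cons form_length_b.
case: s => [|[] s]; first by case: f => [[] [[]|]].
- have := form_length_toggle (s, f); rewrite !form_length_cons.
  by rewrite -(surjective_pairing (toggle (s, f))).
- rewrite form_length_cons form_length_b; set k := form_length _; lia.
Qed.

Lemma form_length_product n g :
  is_product Gabc_gens n g -> (form_length (form g) <= n)%N.
Proof.
case=> xs [<- + ->]; rewrite gens_symmetric.
elim: xs => [_|x xs IHxs xsS]; first by rewrite big_nil /form act1.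
rewrite big_cons /form actM.
apply: leq_trans (form_length_act _ _ _) _.
  by apply: xsS; rewrite mem_head.
by rewrite ltnS IHxs // => y yxs; apply: xsS; rewrite inE yxs orbT.
Qed.

Lemma normal_word_gens x : {subset normal_word x <= Gabc_gens}.
Proof.
have aS : gen_a \in Gabc_gens by rewrite !inE eqxx.
have bS : gen_b \in Gabc_gens by rewrite !inE eqxx orbT.
have cS : gen_c \in Gabc_gens by rewrite !inE eqxx !orbT.
case: x => d [s f]; apply/allP; rewrite /normal_word /= all_cat.
apply/andP; split.
  by case: d => //=; rewrite bS.
elim: s => [|e s IHs] /=; last by case: e; rewrite /= ?aS bS cS.
by case: f => [[] [[]|]]; rewrite /= ?aS ?cS.
Qed.

Lemma word_lengthE g :
  word_length Gabc_gens_generate g = form_length (form g).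
Proof.
rewrite /word_length; case: ex_minnP => n /asboolP gn nmin.
apply/anti_leq; rewrite form_length_product // andbT.
apply: nmin; apply/asboolP; exists (normal_word (form g)); split => //.
  by rewrite gens_symmetric; apply: normal_word_gens.
by rewrite -[LHS]formK.
Qed.

End Group.

(** * Counting normal forms *)

(** The sequences of blocks cb (false) and acb (true) of total length at
    most n. *)
Fixpoint blocks (n : nat) : seq (seq bool) :=
  [::] ::
  match n with
  | n'.+2 => map (cons false) (blocks n') ++
      (if n' is n''.+1 then map (cons true) (blocks n'') else [::])
  | _ => [::]
  end.

Lemma blocks_rec n : blocks n.+3 =
  [::] :: map (cons false) (blocks n.+1) ++ map (cons true) (blocks n).
Proof. by []. Qed.

Lemma mem_blocks n s : (s \in blocks n) = (\sum_(e <- s) e.+2 <= n)%N.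
Proof.
have mem_cons e e' (s' : seq bool) r :
    (e :: s' \in map (cons e') r) = (e == e') && (s' \in r).
  apply/mapP/andP => [[r' r'r [-> ->]]|[/eqP-> s'r]]; first by rewrite eqxx.
  by exists s'.
elim: s n => [|e s IHs] n; first by rewrite big_nil; case: n.
rewrite big_cons; case: n => [|[|[|n]]].
- by case: e.
- by case: e.
- have -> : blocks 2 = [::] :: map (cons false) (blocks 0) ++ [::] by [].
  by rewrite inE mem_cat mem_cons in_nil orbF IHs; case: e; rewrite ?addSn/=.
- rewrite blocks_rec inE mem_cat !mem_cons !IHs.
  by case: e => /=; lia.
Qed.

Lemma blocks_uniq n : uniq (blocks n).
Proof.
elim/ltn_ind: n => -[|[|[|n]]] // IHn.
have inj e : injective (@cons bool e) by move=> ? ? [].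
rewrite blocks_rec cons_uniq mem_cat negb_or cat_uniq.
rewrite !(map_inj_uniq (inj _)) (IHn n.+1 (leqnSn _)).
rewrite (IHn n (leqW (leqnSn _))) ?andbT.
apply/andP; split; first (apply/andP; split).
- by apply/mapP => -[].
- by apply/mapP => -[].
- by apply/hasPn => _ /mapP[s _ ->]; apply/mapP => -[].
Qed.

Lemma size_blocks n :
  size (blocks n.+3) = (size (blocks n.+1) + size (blocks n)).+1.
Proof. by rewrite blocks_rec /= size_cat !size_map. Qed.

Lemma form_lengthE d s f : form_length (d, (s, f)) =
  (d + \sum_(e <- s) e.+2 + size (end_word f))%N.
Proof.
rewrite /form_length /normal_word /= size_cat size_nseq -addnA; congr addn.
elim: s => [|e s IHs]; first by rewrite big_nil.
by rewrite big_cons /= size_cat /= IHs size_nseq; lia.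
Qed.

(** The lower bound comes from the forms made of blocks only; the factor 12
    counts the choices for the initial b and for the end. *)
Lemma growth_function_bounds n :
  (size (blocks n) <= growth_function Gabc_gens_generate n
    <= 12 * size (blocks n))%N.
Proof.
rewrite /growth_function; set B := [set g | _].
pose forms : seq normal_form := [seq (p.1, (s, p.2)) |
  p <- enum {: bool * (bool * option bool)}, s <- blocks n].
have Bforms g : B g -> g \in map value forms.
  rewrite /B /= word_lengthE => gn; rewrite -[g]formK map_f //.
  move: gn; case: (form g) => d [s f]; rewrite form_lengthE => sn.
  apply: (@allpairs_f _ _ _ (fun p s => (p.1, (s, p.2))) _ _ (d, f) s).
    by rewrite mem_enum.
  by rewrite mem_blocks; apply: leq_trans sn; rewrite -addnA addnCA leq_addr.
have finB : finite_set B.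
  apply: (@sub_finite_set _ _ [set` map value forms]); first exact: Bforms.
  exact: finite_seq.
apply/andP; split.
  pose v s := value (false, (s, (false, None))).
  rewrite -(size_map v); apply: uniq_leq_size.
    by rewrite map_inj_uniq ?blocks_uniq // => s s' /(can_inj valueK)[].
  move=> _ /mapP[s + ->]; rewrite mem_blocks => sn.
  rewrite in_fset_set // inE /B /= word_lengthE valueK form_lengthE.
  by rewrite /= addn0.
have -> : (12 * size (blocks n) = size (map value forms))%N.
  by rewrite size_map size_allpairs -cardE !card_prod card_option !card_bool.
apply: uniq_leq_size => [|g]; first exact: fset_uniq.
by rewrite in_fset_set // inE; apply: Bforms.
Qed.

(** * Growth rates *)

Section Analysis.
Variable R : realType.
Implicit Types (c C a : R) (u : nat -> R).

Lemma cvg_root_cst c : 0 < c -> (fun n => c `^ n%:R^-1) @ \oo --> (1 : R).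
Proof.
move=> c0.
have -> : (fun n => c `^ n%:R^-1) = expR \o (fun n => n%:R^-1 * ln c).
  by apply/funext => n; rewrite /powR gt_eqF.
rewrite -[X in _ --> X]expR0.
apply: continuous_cvg; first exact: continuous_expR.
rewrite -[X in _ --> X](mul0r (ln c)); apply: cvgMr_tmp.
apply/gtr0_cvgV0; last exact: cvgr_idn.
by near=> n; rewrite ltr0n; near: n; exact: nbhs_infty_gt.
Unshelve. all: by end_near. Qed.

Lemma exponential_growth_rate c C a u : 0 < c -> 0 < a ->
  (forall n, c * a ^+ n <= u n <= C * a ^+ n) ->
  (fun n => u n `^ n%:R^-1) @ \oo --> a.
Proof.
move=> c0 a0 cuC.
have C0 : 0 < C.
  rewrite (lt_le_trans c0) //; have /andP[cu uC] := cuC 0%N.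
  by have := le_trans cu uC; rewrite expr0 !mulr1.
have root_exp k n : 0 < k -> (0 < n)%N ->
    (k * a ^+ n) `^ n%:R^-1 = k `^ n%:R^-1 * a.
  move=> k0 n0; rewrite powRM ?exprn_ge0 ?(ltW k0) ?(ltW a0) //; congr *%R.
  rewrite -powR_mulrn ?(ltW a0) // -powRrM.
  by rewrite mulfV ?powRr1 ?pnatr_eq0 -?lt0n // ltW.
apply: (@squeeze_cvgr _ _ _ _ (fun n => c `^ n%:R^-1 * a)
                              (fun n => C `^ n%:R^-1 * a)).
- near=> n.
  have n0 : (0 < n)%N by near: n; exact: nbhs_infty_gt.
  have /andP[cu uC] := cuC n.
  have cn0 k : 0 < k -> 0 <= k * a ^+ n.
    by move=> k0; rewrite mulr_ge0 ?exprn_ge0 ?ltW.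
  have u0 : 0 <= u n by apply: le_trans cu; exact: cn0.
  by rewrite -!root_exp // !ge0_ler_powR ?invr_ge0 // nnegrE ?u0 ?cn0.
- by rewrite -[X in _ --> X]mul1r; apply: cvgMr_tmp; exact: cvg_root_cst.
- by rewrite -[X in _ --> X]mul1r; apply: cvgMr_tmp; exact: cvg_root_cst.
Unshelve. all: by end_near. Qed.

(** The additive 1 in the recurrence of P = size (blocks n) disappears in
    P + 1, which satisfies P(n+3) + 1 = (P(n+1) + 1) + (P(n) + 1); for the lower
    bound it can be dropped.  Powers of a satisfy the same recurrence, and the
    constants a^-2 and 3 are chosen to fit the values P = 1, 1, 2 at
    n = 0, 1, 2. *)
Lemma blocks_bounds a : 1 <= a -> a ^+ 3 = a + 1 -> forall n,
  a ^- 2 * a ^+ n <= (size (blocks n))%:R <= 3 * a ^+ n.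
Proof.
move=> a1 a3 n.
have a0 : 0 < a by lra.
have a2 : 1 <= a ^+ 2 by rewrite expr_ge1 // ltW.
suff: a ^+ n <= (size (blocks n))%:R * a ^+ 2 /\
      (size (blocks n))%:R + 1 <= 3 * a ^+ n.
  case=> lb ub; rewrite mulrC ler_pdivrMr ?exprn_gt0 // lb /=; lra.
elim/ltn_ind: n => -[|[|[|n]]] IHn.
- by rewrite /= expr0; split; nra.
- by rewrite /= expr1; split; nra.
- by rewrite /=; split; nra.
have [lb1 ub1] := IHn n.+1 (leqnSn _).
have [lb0 ub0] := IHn n (leqW (leqnSn _)).
have -> : a ^+ n.+3 = a ^+ n.+1 + a ^+ n by rewrite exprS exprS exprS; ring: a3.
rewrite size_blocks -natr1 natrD; split; nra.
Qed.

Lemma cubic_root : exists2 a : R, 1 < a &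
  unique (fun z : R => 0 < z /\ root ('X^3 - 'X - 1) z) a.
Proof.
have rootE (z : R) : root ('X^3 - 'X - 1) z = (z ^+ 3 - z - 1 == 0).
  by rewrite /root !hornerE.
have [||a /andP[a1 _] ra] := @poly_ivt R ('X^3 - 'X - 1) 1 2.
- lra.
- by rewrite !hornerE; apply/andP; split; lra.
(* A positive root satisfies z (z^2 - 1) = 1, hence exceeds 1. *)
have gt1 (z : R) : 0 < z -> z ^+ 3 - z - 1 = 0 -> 1 < z.
  by move=> z0 z3; rewrite ltNge; apply/negP => z1; nra.
move: ra; rewrite rootE => /eqP a3.
have {}a1 : 1 < a by apply: gt1 => //; lra.
exists a => //; split; first by rewrite rootE a3 eqxx; split=> //; lra.
move=> z [z0]; rewrite rootE => /eqP z3; have z1 := gt1 _ z0 z3.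
have : (a - z) * (a ^+ 2 + a * z + z ^+ 2 - 1) = 0.
  by rewrite -[RHS](subrr 0) -{1}a3 -z3; ring.
(* The second factor is positive, because a and z exceed 1. *)
move/eqP; rewrite mulf_eq0 subr_eq0 => /orP[/eqP //|/eqP]; nra.
Qed.

End Analysis.

Theorem proposition18 (R : realType) :
  exists alpha : R,
    [/\ unique (fun z : R => 0 < z /\ root ('X^3 - 'X - 1) z) alpha,
        cvgn (growth_root R Gabc_gens_generate) &
        growth_rate R Gabc_gens_generate = alpha].
Proof.
have [a a1 a_root] := cubic_root R; exists a.
have a0 : 0 < a by lra.
have a3 : a ^+ 3 = a + 1.
  by case: a_root => -[_ +] _; rewrite /root !hornerE => /eqP; lra.
suff lima : growth_root R Gabc_gens_generate @ \oo --> a.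
  by split=> //; [apply: cvgP lima | apply: cvg_lim lima].
(* 36 = 12 * 3: at most 12 forms per block sequence, and P(n) <= 3 a^n. *)
apply: (@exponential_growth_rate _ (a ^- 2) 36) => // [|n].
  by rewrite invr_gt0 exprn_gt0.
have /andP[lb ub] := growth_function_bounds n.
have /andP[lb' ub'] := blocks_bounds R a (ltW a1) a3 n.
apply/andP; split; first by rewrite (le_trans lb') // ler_nat.
rewrite -(ler_nat R) natrM in ub; lra.
Qed.
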